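(* Let $m\ge 2$ be an integer and let $P_{-4,n}(c)$, $n\ge0$, be the polynomials in $c$ defined by $P_{-4,0}=1$, $P_{-4,1}=P_{-4,2}=P_{-4,3}=0$ and $$(km+m+4)\,P_{-4,k+4}(c)=2c\,((k-1)m+2)\,P_{-4,k+2}(c)-(k-3)m\,P_{-4,k}(c),\qquad k\ge0 .$$ Then, up to a nonzero constant factor independent of $n$, the polynomials $q_n(x):=P_{-4,2n+4}(x)$, $n\ge0$, are the associated ultraspherical polynomials $C_n^{(\nu)}(x;\gamma)$ with parameters $\nu=-\frac1m$ and $\gamma=\frac12+\frac2m$.
   Context: For parameters $\nu,\gamma$, the associated ultraspherical polynomials $C_n^{(\nu)}(x;\gamma)$ are defined by $C_{-1}^{(\nu)}(x;\gamma)=0$, $C_0^{(\nu)}(x;\gamma)=1$ and, for $n\ge0$, $$2x(n+\nu+\gamma)\,C_n^{(\nu)}(x;\gamma)=(n+\gamma+1)\,C_{n+1}^{(\nu)}(x;\gamma)+(2\nu+n+\gamma-1)\,C_{n-1}^{(\nu)}(x;\gamma).$$ All $P_{-4,n}$ with $n$ odd vanish, as does $P_{-4,2}$. *)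

(* Defs.v *)
From mathcomp Require Import all_boot all_order all_algebra.
Set Implicit Arguments.
Unset Strict Implicit.
Unset Printing Implicit Defensive.
Import Order.TTheory GRing.Theory Num.Theory.
Local Open Scope ring_scope.

(* Associated ultraspherical polynomials C_n^(nu)(x; gamma), x being 'X.  The
   three-term recurrence is solved for its top term; it determines C_(n+1) only
   when n + gamma + 1 != 0, see assoc_ultrasphericalE.  The missing predecessor
   of index 0 is C_(-1) = 0. *)
Fixpoint assoc_ultraspherical (R : numFieldType) (nu gamma : R) (n : nat)
    : {poly R} :=
  if n is k.+1 then
    (k%:R + gamma + 1)^-1 *:
      ((2 * (k%:R + nu + gamma)) *: ('X * assoc_ultraspherical nu gamma k)
       - (2 * nu + k%:R + gamma - 1) *:
           (if k is j.+1 then assoc_ultraspherical nu gamma j else 0))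
  else 1.

Lemma assoc_ultrasphericalE (R : numFieldType) (nu gamma : R) (n : nat) :
  n%:R + gamma + 1 != 0 ->
  (2 * (n%:R + nu + gamma)) *: ('X * assoc_ultraspherical nu gamma n) =
  (n%:R + gamma + 1) *: assoc_ultraspherical nu gamma n.+1
  + (2 * nu + n%:R + gamma - 1) *:
      (if n is j.+1 then assoc_ultraspherical nu gamma j else 0).
Proof. by move=> nz; rewrite [in RHS]/= scalerA divff // scale1r subrK. Qed.

(* The polynomials P_{-4,n}(c), c being 'X; as the leading coefficient
   k m + m + 4 never vanishes, they are determined by the recurrence
   Pm4E. *)
Fixpoint Pm4 (R : numFieldType) (m n : nat) : {poly R} :=
  match n with
  | 0 => 1
  | 1 | 2 | 3 => 0
  | ((k.+2) as k2).+2 =>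
      (k%:R * m%:R + m%:R + 4)^-1 *:
        ((2 * ((k%:R - 1) * m%:R + 2)) *: ('X * Pm4 R m k2)
         - ((k%:R - 3) * m%:R) *: Pm4 R m k)
  end.

Lemma Pm4E (R : numFieldType) (m k : nat) :
  (k%:R * m%:R + m%:R + 4) *: Pm4 R m (k + 4) =
  (2 * ((k%:R - 1) * m%:R + 2)) *: ('X * Pm4 R m (k + 2))
  - ((k%:R - 3) * m%:R) *: Pm4 R m k.
Proof.
rewrite addn4 addn2 [in LHS]/= scalerA divff ?scale1r //.
by rewrite -natrM -!natrD pnatr_eq0 addn_eq0 andbF.
Qed.

(* Main.v *)
Require Import Defs.
From mathcomp Require Import all_boot all_order all_algebra.
From mathcomp Require Import ring.
Set Implicit Arguments.
Unset Strict Implicit.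
Unset Printing Implicit Defensive.
Import Order.TTheory GRing.Theory Num.Theory.
Local Open Scope ring_scope.

(** Taking k = 2n+2 in the recurrence of P_{-4} and dividing by 2m gives the
    ultraspherical recurrence for q_n = P_{-4,2n+4}, with q_{-1} = P_{-4,2} = 0.
    Both sequences therefore differ by the factor q_0 = 3m/(m+4). *)

Lemma Pm4_even_recurrence (R : numFieldType) (m n : nat) (nu gamma : R) :
  (0 < m)%N -> nu = - (1 / m%:R) -> gamma = 1 / 2 + 2 / m%:R ->
  (n%:R + gamma + 1) *: Pm4 R m (2 * n.+1 + 4) =
  (2 * (n%:R + nu + gamma)) *: ('X * Pm4 R m (2 * n + 4))
  - (2 * nu + n%:R + gamma - 1) *: Pm4 R m (2 * n + 2).
Proof.
move=> m_gt0 -> ->.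
have m_neq0 : m%:R != 0 :> R by rewrite pnatr_eq0 -lt0n.
have two_neq0 : 2 != 0 :> R by rewrite pnatr_eq0.
have /(congr1 (fun p => (2 * m%:R)^-1 *: p)) := Pm4E R m (2 * n + 2).
rewrite scalerBr !scalerA.
have -> : (2 * n + 2 + 4 = 2 * n.+1 + 4)%N by rewrite mulnS (addnC 2).
have -> : (2 * n + 2 + 2 = 2 * n + 4)%N by rewrite -addnA.
rewrite natrD natrM => rec.
(* The leading factor is ((2n+3)m + 4)/(2m) = n + 3/2 + 2/m, which is n + gamma + 1. *)
transitivity (((2 * m%:R)^-1 * ((2 * n%:R + 2) * m%:R + m%:R + 4)) *:
                Pm4 R m (2 * n.+1 + 4)).
  by congr (_ *: _); field; rewrite m_neq0.
(* Here nu + gamma = 1/2 + 1/m, and 2 nu + gamma - 1 = -1/2 since the terms 2/m cancel. *)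
by rewrite rec; congr (_ *: _ - _ *: _); field; rewrite m_neq0.
Qed.

Theorem mainTheorem6 (R : numFieldType) (m : nat) (hm : (2 <= m)%N) :
  exists2 a : R, a != 0 &
    forall n : nat,
      Pm4 R m (2 * n + 4) =
      a *: assoc_ultraspherical (- (1 / m%:R)) (1 / 2 + 2 / m%:R) n.
Proof.
have m_gt0 : (0 < m)%N := ltnW hm.
set nu : R := - _; set gamma : R := 1 / 2 + _.
(* As [gamma] is nonnegative, the recurrence determines its top term at every index. *)
have lead_neq0 n : n%:R + gamma + 1 != 0.
  by rewrite gt_eqF // ltr_wpDl // !addr_ge0 ?divr_ge0 ?ler0n.
have rec n := Pm4_even_recurrence n m_gt0 (erefl nu) (erefl gamma).
have m4_neq0 : m%:R + 4 != 0 :> R by rewrite -natrD pnatr_eq0 addn_eq0 andbF.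
exists (3 * m%:R / (m%:R + 4)).
  by rewrite !mulf_neq0 ?invr_eq0 ?pnatr_eq0 // -lt0n.
set a := _ / _.
(* At k = 0 the term P_{-4,2} vanishes and (m+4) P_{-4,4} = 3m remains. *)
have base : Pm4 R m 4 = a *: 1.
  have := Pm4E R m 0; rewrite /= mulr0 scaler0 mul0r !add0r -scaleNr => E.
  apply: (scalerI m4_neq0); rewrite E scalerA; congr (_ *: _).
  by rewrite /a; field.
(* The recurrence reaches back two terms, so the induction carries the identity for the preceding
   index too; at n = 0 that one reads P_{-4,2} = 0. *)
move=> n; suff [] : Pm4 R m (2 * n + 4) = a *: assoc_ultraspherical nu gamma n
    /\ Pm4 R m (2 * n + 2) =
       a *: (if n is j.+1 then assoc_ultraspherical nu gamma j else 0) by [].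
elim: n => [|n [IH1 IH0]]; first by rewrite scaler0.
split; last by rewrite -IH1 mulnS addnC addnA [in RHS]addnC.
(* After multiplication by n + gamma + 1, both sides expand by the same recurrence. *)
apply: (scalerI (lead_neq0 n)); rewrite rec IH1 IH0 -scalerAr.
have := assoc_ultrasphericalE nu (lead_neq0 n).
move: (assoc_ultraspherical _ _ n.+1) => q_next /esym/(canRL (addrK _)) rec_next.
rewrite [RHS]scalerA [X in X *: q_next]mulrC -[RHS]scalerA rec_next.
by rewrite scalerBr !scalerA ![_ * a]mulrC.
Qed.
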